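(* Let $d\geq 2$, let $\mathcal{P}$ be a finite classical polar space of rank $d+2$ with parameter $e\leq 1$ over $\mathbb{F}_q$ naturally embedded in $\mathrm{PG}(n+3,q)$, and let $\alpha\cong\mathrm{PG}(n,q)$ be an $(n+1)$-dimensional (vector dimension) subspace of $\mathrm{PG}(n+3,q)$ that intersects $\mathcal{P}$ in a polar space $\mathcal{P}'$ of rank $d$ with parameter $e+1$. Thus one of the following holds: $n=2d$, $\mathcal{P}=\mathcal{Q}^+(2d+3,q)$, $\mathcal{P}'=\mathcal{Q}(2d,q)$; or $n=2d$, $q$ is a square, $\mathcal{P}=\mathcal{H}(2d+3,q)$, $\mathcal{P}'=\mathcal{H}(2d,q)$; or $n=2d+1$, $\mathcal{P}=\mathcal{Q}(2d+4,q)$, $\mathcal{P}'=\mathcal{Q}^-(2d+1,q)$. Let $\mathcal{M}$ be a regular $(m,d-1)$-ovoid of type $1$ in $\mathcal{P}'$, and let $\mathcal{L}$ be the set of generators of $\mathcal{P}$ that meet $\alpha$ in a subspace of dimension $d-1$ which is an element of $\mathcal{M}$. If $\mathcal{M}$ is not the set of generators of an embedded polar space of rank $d-1$ and parameter $e+2$ inside $\mathcal{P}'$, then $\mathcal{L}$ does not contain the set of all generators of a polar space of rank $d+2$ with parameter $e-1$ over $\mathbb{F}_q$ that is embedded in $\mathcal{P}$.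
   Context: All dimensions are vector space dimensions; an $a$-space is a totally isotropic (totally singular) subspace of dimension $a$. The finite classical polar spaces of rank $D$ over $\mathbb{F}_q$ are the hyperbolic quadric $\mathcal{Q}^+(2D-1,q)$, the Hermitian space $\mathcal{H}(2D-1,q)$ ($q$ a square), the symplectic space $\mathcal{W}(2D-1,q)$, the parabolic quadric $\mathcal{Q}(2D,q)$, the Hermitian space $\mathcal{H}(2D,q)$ ($q$ a square) and the elliptic quadric $\mathcal{Q}^-(2D+1,q)$, with parameter $e=0,\tfrac12,1,1,\tfrac32,2$ respectively; the first number in parentheses is the projective dimension of the ambient space. Generators are the $D$-spaces; through each $(D-1)$-space there are $q^e+1$ generators. $\Omega_a$ denotes the set of $a$-spaces, $\boldsymbol{j}$ an all-ones vector. An embedded polar space of rank $d-1$ and parameter $e+2$ inside $\mathcal{P}'$ is a polar space of this rank and parameter over $\mathbb{F}_q$ arising as the intersection of $\mathcal{P}'$ with a hyperplane of $\alpha$ (only possible for $e=0$; for $d=2$ it has rank 1 and its generators are points). A polar space of rank $d+2$ with parameter $e-1$ embedded in $\mathcal{P}$ can only exist if $e=1$, i.e. $\mathcal{P}=\mathcal{Q}(2d+4,q)$; it is then a hyperbolic quadric $\mathcal{Q}^+(2d+3,q)$ arising as the intersection of $\mathcal{P}$ with a hyperplane, and its generators are generators of $\mathcal{P}$. For a polar space of rank $d$, let $C_{a,b}:\mathbb{R}^{\Omega_a}\to\mathbb{R}^{\Omega_b}$ be the incidence map (matrix with rows indexed by $b$-spaces, columns by $a$-spaces, entry 1 if one contains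 the other, 0 otherwise; $C_{a,b}=0$ if $a$ or $b$ is not in $\{0,\dots,d\}$). For $0\le r\le a$, $0\le i\le\min(r,d-a)$ put $V^a_{r,i}=\mathrm{Im}(C_{r,a})\cap\mathrm{Im}(C_{r-1,a})^\perp\cap\mathrm{Im}(C_{d-i,a})\cap\mathrm{Im}(C_{d-i+1,a})^\perp$; then $V^a_{0,0}=\langle\boldsymbol{j}\rangle$ and $\mathbb{R}^{\Omega_a}$ is the orthogonal direct sum of the $V^a_{r,i}$. In the polar space $\mathcal{P}'$ (rank $d$), a set $\mathcal{M}\subseteq\Omega_{d-1}$ is an $(m,d-1)$-ovoid if every generator of $\mathcal{P}'$ contains exactly $m$ elements of $\mathcal{M}$; it is trivial if it is $\emptyset$ or $\Omega_{d-1}$. It is regular if there are constants $c_1,c_2$ such that for each $\pi\in\Omega_{d-1}$ the number of $\rho\in\mathcal{M}$ with $\dim(\rho\cap\pi)=d-2$ and $\langle\rho,\pi\rangle$ not a generator of $\mathcal{P}'$ equals $c_1$ if $\pi\in\mathcal{M}$ and $c_2$ if $\pi\notin\mathcal{M}$. A non-trivial regular $(m,d-1)$-ovoid has type $r$ if its characteristic vector lies in $V^{d-1}_{0,0}\oplus V^{d-1}_{r,1}$ (computed in $\mathcal{P}'$). *)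

(* Defs.v *)
From HB Require Import structures.
From mathcomp Require Import all_boot all_order all_algebra.
From mathcomp Require Import reals.

Set Implicit Arguments.
Unset Strict Implicit.
Unset Printing Implicit Defensive.

Import Order.TTheory GRing.Theory Num.Theory.
Local Open Scope ring_scope.

HB.instance Definition _ (F : finFieldType) (vT : vectType F) :=
  CanIsCountable (@VectorInternalTheory.vs2mxK F vT).
HB.instance Definition _ (F : finFieldType) (vT : vectType F) :
    isFinite {vspace vT} :=
  CanIsFinite (@VectorInternalTheory.vs2mxK F vT).

(* A form on F^N, given by its Gram matrix M. In the quadratic case M is any
   matrix and the form is the homogeneous quadratic polynomial
   sum_(i, j) M i j x_i x_j, so that characteristic 2 is covered. *)
Inductive polar_form (F : finFieldType) (N : nat) : Type :=
| QuadraticForm of 'M[F]_N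
| HermitianForm of {rmorphism F -> F} & 'M[F]_N
| SymplecticForm of 'M[F]_N.

(* An involution theta <> id of F exists only if #|F| is a square, and it is
   then x |-> x ^+ (sqrt #|F|). *)
Definition form_axiom (F : finFieldType) (N : nat) (f : polar_form F N) : Prop :=
  match f with
  | QuadraticForm _ => True
  | HermitianForm theta M =>
      [/\ involutive theta, exists a, theta a != a & M \is (false, theta).-sesqui]
  | SymplecticForm M => forall x : 'rV[F]_N, form idfun M x x = 0
  end.

(* In the quadratic case, Q (x + y) - Q x - Q y. *)
Definition assoc_form (F : finFieldType) (N : nat) (f : polar_form F N)
    (x y : 'rV[F]_N) : F :=
  match f with
  | QuadraticForm M => form idfun (M + M^T) x y
  | HermitianForm theta M => form theta M x y
  | SymplecticForm M => form idfun M x y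
  end.

Definition singular (F : finFieldType) (N : nat) (f : polar_form F N)
    (x : 'rV[F]_N) : bool :=
  match f with
  | QuadraticForm M => form idfun M x x == 0
  | HermitianForm theta M => form theta M x x == 0
  | SymplecticForm M => form idfun M x x == 0
  end.

Definition totally_singular (F : finFieldType) (N : nat) (f : polar_form F N)
    (U : {vspace 'rV[F]_N}) : bool :=
  [forall (x | x \in U), singular f x] &&
  [forall (x | x \in U), forall (y | y \in U), assoc_form f x y == 0].

(* For Hermitian and symplectic forms, singularity of x already follows from
   x being orthogonal to W. For quadratic forms the bilinear form may have a
   non-zero radical (the nucleus of a parabolic quadric in characteristic 2). *)
Definition nondegenerate_on (F : finFieldType) (N : nat) (f : polar_form F N)
    (W : {vspace 'rV[F]_N}) : Prop :=
  forall x, x \in W -> singular f x ->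
    (forall y, y \in W -> assoc_form f x y = 0) -> x = 0.

Definition polar_rank (F : finFieldType) (N : nat) (f : polar_form F N)
    (W : {vspace 'rV[F]_N}) : nat :=
  (\max_(U : {vspace 'rV[F]_N} | totally_singular f U && (U <= W)%VS) \dim U)%N.

(* Q^+(2D-1,q), H(2D-1,q), W(2D-1,q), Q(2D,q), H(2D,q), Q^-(2D+1,q) *)
Variant polar_type : Type :=
  Hyperbolic | HermitianOdd | Symplectic | Parabolic | HermitianEven | Elliptic.

Definition polar_param (t : polar_type) : rat :=
  match t with
  | Hyperbolic => 0
  | HermitianOdd => 1 / 2
  | Symplectic => 1
  | Parabolic => 1
  | HermitianEven => 3 / 2
  | Elliptic => 2
  end.

(* vector space dimension *)
Definition ambient_dim (t : polar_type) (D : nat) : nat :=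
  match t with
  | Hyperbolic | HermitianOdd | Symplectic => D.*2
  | Parabolic | HermitianEven => D.*2.+1
  | Elliptic => D.*2.+2
  end.

Definition form_matches (F : finFieldType) (N : nat) (f : polar_form F N)
    (t : polar_type) : bool :=
  match f, t with
  | QuadraticForm _, (Hyperbolic | Parabolic | Elliptic)
  | HermitianForm _ _, (HermitianOdd | HermitianEven)
  | SymplecticForm _, Symplectic => true
  | _, _ => false
  end.

(* The totally singular subspaces contained in W form a classical polar space
   of rank D and parameter e, naturally embedded in the projective space of W.
   The polar space is represented by the pair (f, W). *)
Definition polar_space (F : finFieldType) (N : nat) (f : polar_form F N)
    (W : {vspace 'rV[F]_N}) (D : nat) (e : rat) : Prop :=
  [/\ form_axiom f, nondegenerate_on f W, polar_rank f W = D &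
      exists t : polar_type,
        [/\ form_matches f t, \dim W = ambient_dim t D & polar_param t = e]].

(* The a-spaces. The index is an integer so that Omega f W (- 1) is empty. *)
Definition Omega (F : finFieldType) (N : nat) (f : polar_form F N)
    (W : {vspace 'rV[F]_N}) (a : int) : {set {vspace 'rV[F]_N}} :=
  [set U | [&& totally_singular f U, (U <= W)%VS & (\dim U)%:Z == a]].

Definition hyperplane_of (F : finFieldType) (N : nat)
    (H W : {vspace 'rV[F]_N}) : bool :=
  (H <= W)%VS && ((\dim H).+1 == \dim W).

(* If a or b is not in {0, ..., rank}, then this matrix is empty, and its
   column space is zero. *)
Definition incidence (R : realType) (F : finFieldType) (N : nat)
    (f : polar_form F N) (W : {vspace 'rV[F]_N}) (a b : int) :
    'M[R]_(#|Omega f W b|, #|Omega f W a|) :=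
  \matrix_(i, j) ((enum_val i <= enum_val j)%VS
                  || (enum_val j <= enum_val i)%VS)%:R.

(* Subspaces of R^Omega_b are encoded as row spaces of matrices; this one is
   the image of the incidence map R^Omega_a -> R^Omega_b. *)
Definition im_incidence (R : realType) (F : finFieldType) (N : nat)
    (f : polar_form F N) (W : {vspace 'rV[F]_N}) (a b : int) :
    'M[R]_(#|Omega f W a|, #|Omega f W b|) :=
  (incidence R f W a b)^T.

(* orthogonal complement for the standard inner product *)
Definition perp (R : realType) (m k : nat) (A : 'M[R]_(m, k)) : 'M[R]_k :=
  orthomx idfun 1%:M A.

(* V^a_{r,i} in the polar space (f, W) of rank d *)
Definition Vspace (R : realType) (F : finFieldType) (N : nat)
    (f : polar_form F N) (W : {vspace 'rV[F]_N}) (d a r i : int) :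
    'M[R]_(#|Omega f W a|) :=
  (im_incidence R f W r a :&: perp (im_incidence R f W (r - 1) a)
   :&: im_incidence R f W (d - i) a
   :&: perp (im_incidence R f W (d - i + 1) a))%MS.

Definition char_vector (R : realType) (F : finFieldType) (N : nat)
    (f : polar_form F N) (W : {vspace 'rV[F]_N}) (a : int)
    (M : {set {vspace 'rV[F]_N}}) : 'rV[R]_(#|Omega f W a|) :=
  \row_i (enum_val i \in M)%:R.

(* (m, d-1)-ovoid of the polar space (f, W) of rank d *)
Definition ovoid (F : finFieldType) (N : nat) (f : polar_form F N)
    (W : {vspace 'rV[F]_N}) (d m : nat) (M : {set {vspace 'rV[F]_N}}) : Prop :=
  M \subset Omega f W d.-1 /\
  forall G, G \in Omega f W d -> #|[set p in M | (p <= G)%VS]| = m.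

Definition trivial_ovoid (F : finFieldType) (N : nat) (f : polar_form F N)
    (W : {vspace 'rV[F]_N}) (d : nat) (M : {set {vspace 'rV[F]_N}}) : Prop :=
  M = set0 \/ M = Omega f W d.-1.

Definition regular_ovoid (F : finFieldType) (N : nat) (f : polar_form F N)
    (W : {vspace 'rV[F]_N}) (d m : nat) (M : {set {vspace 'rV[F]_N}}) : Prop :=
  ovoid f W d m M /\
  exists c1 c2 : nat, forall p, p \in Omega f W d.-1 ->
    #|[set r in M | (\dim (r :&: p)%VS == d.-2)
                    && ((r + p)%VS \notin Omega f W d)]|
    = if p \in M then c1 else c2.

Definition regular_ovoid_of_type (R : realType) (F : finFieldType) (N : nat)
    (f : polar_form F N) (W : {vspace 'rV[F]_N}) (d m r : nat)
    (M : {set {vspace 'rV[F]_N}}) : Prop :=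
  [/\ regular_ovoid f W d m M, ~ trivial_ovoid f W d M &
      (char_vector R f W d.-1 M
         <= Vspace R f W d d.-1 0 0 + Vspace R f W d d.-1 r 1)%MS].

(* Main.v *)
(* Parameter e - 1 forces e = 1: the form is quadratic, P is the parabolic
   quadric Q(2d+4,q), and the embedded polar space lies on a hyperplane H.
   Then H and alpha meet in dimension at least 2d+1, so by Chevalley's theorem
   they share a totally singular d-space U. Extending U to a generator of H
   yields a generator meeting alpha in dimension at least d, which is not in L. *)
Require Import Defs.
From HB Require Import structures.
From mathcomp Require Import all_boot all_order all_algebra.
From mathcomp Require Import reals.
From mathcomp Require Import ring zify.

Set Implicit Arguments.
Unset Strict Implicit.
Unset Printing Implicit Defensive.

Import Order.TTheory GRing.Theory Num.Theory.
Local Open Scope ring_scope.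

(** * Squares in finite fields *)

(** Every element is plus or minus the chosen root of its square, so two images of the set [S] of
    squares cover [F]; both contain 0, which makes the inequality strict. *)
Lemma card_squares (F : finFieldType) : (#|F| < #|[set x ^+ 2 | x : F]|.*2)%N.
Proof.
pose S := [set x ^+ 2 | x : F].
pose root (y : F) := odflt 0 [pick x | x ^+ 2 == y].
have rootK y : y \in S -> root y ^+ 2 = y.
  case/imsetP=> x _ ->; rewrite /root; case: pickP => [z /eqP//|/(_ x)].
  by rewrite eqxx.
have root0 : root 0 = 0.
  apply/eqP; rewrite -sqrf_eq0 rootK //; apply/imsetP; exists 0 => //.
  by rewrite expr0n.
have S0 : 0 \in S by apply/imsetP; exists 0; rewrite // expr0n.
pose T := [set root y | y in S]; pose T' := [set - root y | y in S].
have TT' : T :|: T' = setT.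
  apply/setP=> x; rewrite !inE.
  have Sx : x ^+ 2 \in S by apply: imset_f.
  have /eqP := rootK _ Sx; rewrite eqf_sqr => /orP[]/eqP rx.
    by apply/orP; left; apply/imsetP; exists (x ^+ 2).
  by apply/orP; right; apply/imsetP; exists (x ^+ 2); rewrite ?rx ?opprK.
have TI : (0 < #|T :&: T'|)%N.
  apply/card_gt0P; exists 0; rewrite inE; apply/andP.
  by split; apply/imsetP; exists 0; rewrite ?root0 ?oppr0.
rewrite -addnn -cardsT -TT' -addn1.
apply: leq_trans (leq_add (leq_imset_card root S)
                          (leq_imset_card (fun y => - root y) S)).
by rewrite -/T -/T' -(cardsUI T T') leq_add2l.
Qed.

(** Pigeonhole: the values of [a * s ^+ 2] and those of [c - b * t ^+ 2] each fill more than half of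
    [F], so they share an element. *)
Lemma binary_form_onto (F : finFieldType) (a b c : F) :
  a != 0 -> b != 0 -> exists s t, a * s ^+ 2 + b * t ^+ 2 = c.
Proof.
move=> a0 b0; pose S := [set x ^+ 2 | x : F].
pose A := [set a * y | y in S]; pose B := [set c - b * y | y in S].
have cA : #|A| = #|S| by apply/card_imset/mulfI.
have cB : #|B| = #|S| by apply/card_imset => x y /addrI/oppr_inj/(mulfI b0).
have : (0 < #|A :&: B|)%N.
  rewrite -(ltn_add2l #|A :|: B|) cardsUI cA cB addn0 addnn.
  exact: leq_ltn_trans (max_card _) (card_squares F).
case/card_gt0P=> x; rewrite inE => /andP[/imsetP[_ /imsetP[s _ ->] ->]].
case/imsetP=> _ /imsetP[t _ ->] E; exists s, t; rewrite E; ring.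
Qed.

Lemma char2_sqr_onto (F : finFieldType) (c : F) :
  (2 : F) = 0 -> exists s, s ^+ 2 = c.
Proof.
move=> F2; have inj : injective (fun x : F => x ^+ 2).
  move=> x y /= E; apply/eqP; rewrite -subr_eq0 -sqrf_eq0.
  by rewrite sqrrB E -mulr_natl F2 mul0r subr0 -mulr2n -mulr_natl F2 mul0r.
by exists (invF inj c); apply: (f_invF inj).
Qed.

Lemma exists_nonzero (K : fieldType) (vT : vectType K) (U : {vspace vT}) :
  (0 < \dim U)%N -> exists2 x, x \in U & x != 0.
Proof.
rewrite lt0n dimv_eq0 => U0; exists (vpick U); first exact: memv_pick.
by rewrite vpick0.
Qed.

Lemma form_tr (K : fieldType) (N : nat) (A : 'M[K]_N) x y :
  form idfun A^T x y = form idfun A y x.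
Proof.
rewrite /form !map_mx_id //.
have -> : x *m A^T *m y^T = (y *m A *m x^T)^T by rewrite !trmx_mul trmxK mulmxA.
by rewrite mxE.
Qed.

(** * Totally singular subspaces of a quadratic form *)

Section Quadratic.
Variables (F : finFieldType) (N : nat) (A : 'M[F]_N).
Local Notation Q x := (form idfun A x x).
Local Notation B := (form idfun (A + A^T)).
Local Notation ts := (totally_singular (QuadraticForm A)).

Lemma polarE x y : B x y = form idfun A x y + form idfun A y x.
Proof. by rewrite -[form idfun A y x]form_tr /form mulmxDr mulmxDl mxE. Qed.

Lemma polarC x y : B x y = B y x.
Proof. by rewrite !polarE addrC. Qed.

Lemma quadD x y : Q (x + y) = Q x + Q y + B x y.
Proof. rewrite polarE !(formDl, formDr); ring. Qed.

Lemma quadZ a x : Q (a *: x) = a ^+ 2 * Q x.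
Proof. rewrite formZl formZr /=; ring. Qed.

Lemma tsP (U : {vspace 'rV[F]_N}) :
  reflect ({in U, forall x, Q x = 0} /\ {in U &, forall x y, B x y = 0}) (ts U).
Proof.
apply: (iffP andP) => -[QU BU]; split.
- by move=> x Ux; have /forall_inP/(_ x Ux)/eqP := QU.
- by move=> x y Ux Uy; have /forall_inP/(_ x Ux)/forall_inP/(_ y Uy)/eqP := BU.
- by apply/forall_inP => x Ux; apply/eqP/QU.
- by apply/forall_inP => x Ux; apply/forall_inP => y Uy; apply/eqP/BU.
Qed.

Lemma ts_add U V :
  ts U -> ts V -> (forall x y, x \in U -> y \in V -> B x y = 0) -> ts (U + V)%VS.
Proof.
move=> /tsP[QU BU] /tsP[QV BV] BUV; apply/tsP; split.
  by move=> _ /memv_addP[u Uu [v Vv ->]]; rewrite quadD QU ?QV ?BUV ?addr0.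
move=> _ _ /memv_addP[u Uu [v Vv ->]] /memv_addP[w Uw [z Vz ->]].
rewrite !(formDl, formDr) BU ?(BV v z) ?(BUV u z) ?[B v w]polarC //.
by rewrite (BUV w v) ?addr0.
Qed.

Lemma ts_sub U V : (U <= V)%VS -> ts V -> ts U.
Proof.
move=> /subvP UV /tsP[QV BV]; apply/tsP.
by split=> [x /UV /QV//|x y /UV Vx /UV /(BV _ _ Vx)].
Qed.

Lemma ts_line x : Q x = 0 -> ts <[x]>%VS.
Proof.
move=> Qx; apply/tsP; split=> [_ /vlineP[a ->]|_ _ /vlineP[a ->] /vlineP[b ->]].
  by rewrite quadZ Qx mulr0.
by rewrite formZl formZr polarE Qx addr0 !mulr0.
Qed.

(** Pairing with a basis of [U] is a linear map into a space of dimension [\dim U]; its kernel in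
    [S] is taken as [T]. *)
Lemma orth_subspace (S U : {vspace 'rV[F]_N}) :
  exists T : {vspace 'rV[F]_N},
    [/\ (T <= S)%VS, (\dim S <= \dim T + \dim U)%N &
        forall x y, x \in T -> y \in U -> B x y = 0].
Proof.
(* The row [x *m C] lists the values of [B x] on the basis of [U]. *)
pose C := (A + A^T) *m (\matrix_(j < \dim U) (vbasis U)`_j)^T.
pose g := linfun (mulmxr C : 'rV[F]_N -> 'rV[F]_(\dim U)).
exists (S :&: lker g)%VS; split; first exact: capvSl.
  rewrite -(limg_ker_dim g S) leq_add2l.
  by apply: leq_trans (dimvS (subvf _)) _; rewrite dimvf dim_matrix mul1r.
move=> x y /memv_capP[_]; rewrite memv_ker lfunE /= => /eqP xC.
move=> /coord_vbasis ->; elim/big_ind: _ => [||i _]; first exact: form0r.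
  by move=> u v Eu Ev; rewrite formDr Eu Ev addr0.
have /rowP/(_ i) := xC; rewrite mulmxA !mxE => E.
rewrite formZr /form !mxE; set s := (X in _ * X).
suff -> : s = 0 by rewrite mulr0.
by rewrite -[RHS]E; apply: eq_bigr => k _; rewrite !mxE.
Qed.

Lemma orth_line (W : {vspace 'rV[F]_N}) x : exists T : {vspace 'rV[F]_N},
  [/\ (T <= W)%VS, (\dim W <= (\dim T).+1)%N & {in T, forall y, B x y = 0}].
Proof.
have [T [TW dT BT]] := orth_subspace W <[x]>; exists T; split=> //.
  apply: leq_trans dT _; rewrite dim_vline -[(\dim T).+1]addn1 leq_add2l; exact: leq_b1.
by move=> y Ty; rewrite polarC BT // memv_line.
Qed.

(* Chevalley's theorem for three variables: in odd characteristic diagonalize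
   and use that a nondegenerate binary form represents every scalar; in
   characteristic 2 every scalar is a square, so an anisotropic vector [x] can be
   rescaled to cancel the value of any vector orthogonal to it. *)
Lemma ternary_isotropic (W : {vspace 'rV[F]_N}) :
  (2 < \dim W)%N -> exists x, [/\ x \in W, x != 0 & Q x = 0].
Proof.
move=> dW; have [x Wx x0] : exists2 x, x \in W & x != 0 by apply: exists_nonzero; lia.
have [Qx|Qx] := eqVneq (Q x) 0; first by exists x.
have [T [/subvP TW dT BT]] := orth_line W x.
have [F2|F2] := eqVneq (2 : F) 0.
  (* Here [B x x] is twice [Q x], hence 0, so [x] may lie in [T]; taking [y] in a complement keeps
     [s *: x + y] non-zero. *)
  have /exists_nonzero[y] : (0 < \dim (T :\: <[x]>)%VS)%N.
    have := dimv_cap_compl T <[x]>; have := dimvS (capvSr T <[x]>).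
    rewrite dim_vline x0; lia.
  move=> yTx y0; have Ty := subvP (diffvSl T <[x]>) _ yTx.
  have [s Es] := char2_sqr_onto (- Q y / Q x) F2.
  exists (s *: x + y); split; first by rewrite rpredD ?rpredZ ?(TW y).
    apply: contraNneq y0 => E.
    rewrite -memv0 -(capv_diff T <[x]>) memv_cap yTx /=.
    move/eqP: E; rewrite addrC addr_eq0 => /eqP ->.
    by rewrite rpredN rpredZ ?memv_line.
  by rewrite quadD quadZ formZl BT // Es divfK // mulr0 addr0 addNr.
have [y Ty y0] : exists2 y, y \in T & y != 0 by apply: exists_nonzero; lia.
have [Qy|Qy] := eqVneq (Q y) 0; first by exists y; rewrite TW.
have [S [/subvP ST dS BS]] := orth_line T y.
have [z Sz z0] : exists2 z, z \in S & z != 0 by apply: exists_nonzero; lia.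
have Tz := ST _ Sz.
have [Qz|Qz] := eqVneq (Q z) 0; first by exists z; rewrite TW.
have [s [t Est]] := binary_form_onto (- Q z) Qx Qy.
exists (s *: x + t *: y + z); split.
- by rewrite !rpredD ?rpredZ ?(TW y) ?(TW z).
(* Pairing the sum with [z] leaves only twice [Q z], which is non-zero. *)
- apply/eqP => E; have := form0l idfun (A + A^T) z; rewrite -E !formDl !formZl.
  rewrite BT // BS // !mulr0 !add0r polarE -mulr2n -mulr_natl => /eqP.
  by rewrite mulf_eq0 (negPf F2) (negPf Qz).
- rewrite !quadD !quadZ !(formDl, formZl, formZr) BT // BT // BS //=.
  rewrite -[Q z]opprK -Est; ring.
Qed.

(** Induction on [k]: within [W], a complement of [U] in its orthogonal space still has dimension at
    least 3, so it contains a singular vector by which [U] can be enlarged. *)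
Lemma ts_exists k (W : {vspace 'rV[F]_N}) : (k.*2 < \dim W)%N ->
  exists U : {vspace 'rV[F]_N}, [/\ ts U, (U <= W)%VS & \dim U = k].
Proof.
elim: k => [_|k IH dW].
  exists 0%VS; rewrite sub0v dimv0; split=> //; apply/tsP.
  by split=> [x|x y]; rewrite memv0 => /eqP ->; [|move=> _]; rewrite form0l.
have [|U [tsU UW dU]] := IH; first by move: dW; rewrite doubleS; lia.
have [T [TW dT BT]] := orth_subspace W U.
have [|x [xTU x0 Qx]] := @ternary_isotropic (T :\: U)%VS.
  have := dimv_cap_compl T U; have := dimvS (capvSr T U).
  by move: dW dT; rewrite dU doubleS; lia.
have Tx := subvP (diffvSl T U) _ xTU.
exists (U + <[x]>)%VS; split.
- apply: ts_add => //; first exact: ts_line.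
  move=> u _ Uu /vlineP[a ->].
  by rewrite formZr polarC BT ?mulr0.
- by rewrite subv_add UW -memvE (subvP TW).
- rewrite dimv_disjoint_sum ?dim_vline ?x0 ?dU ?addn1 //.
  apply/eqP; rewrite -subv0; apply/subvP=> y /memv_capP[Uy /vlineP[a E]].
  by rewrite -(capv_diff T U) memv_cap Uy andbT E rpredZ.
Qed.

(* [U + (G :&: U^perp)] is totally singular and no smaller than [G]. *)
Lemma ts_extend U G H : ts U -> ts G -> (U <= H)%VS -> (G <= H)%VS ->
  exists G' : {vspace 'rV[F]_N},
    [/\ ts G', (U <= G')%VS, (G' <= H)%VS & (\dim G <= \dim G')%N].
Proof.
move=> tsU tsG UH GH.
(* The part [U :&: G] is already orthogonal to [G]. Imposing orthogonality to a complement of it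
   alone costs at most what adding [U] gains back. *)
have [T [TG dT BT]] := orth_subspace G (U :\: G).
exists (U + T)%VS; split; first last.
- have := dimv_sum_cap U T; have := dimv_cap_compl U G.
  by have := dimvS (capvS (subvv U) TG); lia.
- by rewrite subv_add UH (subv_trans TG GH).
- exact: addvSl.
apply: ts_add => //; first exact: ts_sub TG tsG.
have /tsP[_ BG] := tsG.
move=> x y; rewrite -{1}(addv_diff_cap U G).
case/memv_addP=> u Uu [v /memv_capP[_ Gv] ->] Ty.
by rewrite formDl polarC BT // add0r BG // (subvP TG).
Qed.

End Quadratic.

(** * Generators of the embedded polar space *)

Lemma polar_rank_attained (F : finFieldType) (N : nat) (A : 'M[F]_N)
    (W : {vspace 'rV[F]_N}) :
  exists U, [/\ totally_singular (QuadraticForm A) U, (U <= W)%VS &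
               \dim U = polar_rank (QuadraticForm A) W].
Proof.
pose P (U : {vspace 'rV[F]_N}) :=
  totally_singular (QuadraticForm A) U && (U <= W)%VS.
have P0 : P 0%VS.
  rewrite /P sub0v andbT; apply/tsP.
  by split=> [x|x y]; rewrite memv0 => /eqP ->; [|move=> _]; rewrite form0l.
have [|U PU EU] := @eq_bigmax_cond _ P (fun U => \dim U).
  by apply/card_gt0P; exists 0%VS.
by exists U; have /andP[] := PU; rewrite -EU.
Qed.

Theorem theorem6p5 (R : realType) (F : finFieldType) (n d m : nat) (e : rat)
    (f : polar_form F n.+4) (alpha : {vspace 'rV[F]_n.+4})
    (M : {set {vspace 'rV[F]_n.+4}})
    (hd : (2 <= d)%N) (he : e <= 1)
    (hP : polar_space f fullv d.+2 e)
    (halpha : \dim alpha = n.+1)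
    (hP' : polar_space f alpha d (e + 1))
    (hM : regular_ovoid_of_type R f alpha d m 1%N M)
    (hMemb : ~ exists H : {vspace 'rV[F]_n.+4},
        [/\ hyperplane_of H alpha, polar_space f H d.-1 (e + 2)
          & M = Omega f H d.-1]) :
  let L := [set G in Omega f fullv d.+2 |
             (\dim (G :&: alpha)%VS == d.-1) && ((G :&: alpha)%VS \in M)] in
  ~ exists H : {vspace 'rV[F]_n.+4},
      [/\ hyperplane_of H fullv, polar_space f H d.+2 (e - 1)
        & Omega f H d.+2 \subset L].
Proof.
move=> L [H [/andP[_ /eqP dH] [_ _ rH [tH [fH _ eH]]] HL]].
have fQ : exists2 A, f = QuadraticForm A & e = 1.
  (* Only the hyperbolic type has a parameter that is at most 0. *)
  have e1 : polar_param tH <= 0 by rewrite eH subr_le0.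
  case: tH e1 fH eH {rH HL} => // _.
  case: f {hP hP' hM hMemb L dH} => // A _ /esym/eqP.
  by rewrite subr_eq0 => /eqP; exists A.
case: fQ => A fA e1; subst f e.
(* The parabolic type is the only quadratic one of parameter 1. *)
have n2d : n = d.*2.+1.
  case: hP => _ _ _ [t [ft dt et]].
  case: t ft et dt => // _ _; rewrite dimvf dim_matrix mul1r /=; lia.
have dW : (d.*2 < \dim (H :&: alpha))%N.
  have := dimv_sum_cap H alpha; have := dimvS (subvf (H + alpha)%VS).
  by move: dH; rewrite halpha dimvf dim_matrix mul1r; lia.
have [U [tsU UW dU]] := ts_exists A dW.
have UH := subv_trans UW (capvSl _ _).
have Ual := subv_trans UW (capvSr _ _).
have [G [tsG GH dG]] := polar_rank_attained A H.
have [G' [tsG' UG' G'H dGG']] := ts_extend tsU tsG UH GH.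
(* At least [d.+2] by comparison with [G], at most [d.+2] by maximality of the rank. *)
have dG' : \dim G' = d.+2.
  apply/eqP; rewrite eqn_leq -{2}rH -dG dGG' andbT -rH.
  by apply: leq_bigmax_cond; rewrite tsG' G'H.
have : G' \in Omega (QuadraticForm A) H d.+2 by rewrite inE tsG' G'H dG' eqxx.
move/(subsetP HL); rewrite inE => /and3P[_ /eqP dcap _].
(* This forces [d] to be at most [d.-1], which [hd] excludes. *)
have : (U <= G' :&: alpha)%VS by rewrite subv_cap UG'.
by move/dimvS; rewrite dcap dU; lia.
Qed.
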